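(* Let $m>1$ and $n$ be integers. (i) If $3\nmid m$, then $$\left\lfloor\frac{15n-1}{m}\right\rfloor+\left\lfloor\frac{2}{m}\right\rfloor+\left\lfloor\frac{4n}{m}\right\rfloor\ \geqslant\ \left\lfloor\frac{12n+2}{m}\right\rfloor+\left\lfloor\frac{2n}{m}\right\rfloor+\left\lfloor\frac{5n-1}{m}\right\rfloor.$$ (ii) If $5\nmid m$, then $$\left\lfloor\frac{15n-1}{m}\right\rfloor+\left\lfloor\frac{2n}{m}\right\rfloor\ \geqslant\ \left\lfloor\frac{10n+1}{m}\right\rfloor+\left\lfloor\frac{4n}{m}\right\rfloor+\left\lfloor\frac{3n-1}{m}\right\rfloor.$$ *)

(* Defs.v *)
From mathcomp Require Import all_boot all_order all_algebra.

Set Implicit Arguments.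
Unset Strict Implicit.
Unset Printing Implicit Defensive.

Import Order.TTheory GRing.Theory Num.Theory.
Local Open Scope ring_scope.

Definition floor_quot (a b : int) : int := Num.floor (a%:~R / b%:~R : rat).

(* Main.v *)
(* Both inequalities are invariant under n -> n + m, so assume 0 <= n < m. Then
   every floor other than that of (15n-1)/m takes boundedly many values; fixing
   them confines n to an interval with endpoints linear in m, on which the
   required lower bound for 15n-1 is linear integer arithmetic. *)
Require Import Defs.
From mathcomp Require Import all_boot all_order all_algebra.
From mathcomp Require Import zify.

Set Implicit Arguments.
Unset Strict Implicit.
Unset Printing Implicit Defensive.

Import Order.TTheory GRing.Theory Num.Theory.
Local Open Scope ring_scope.

Lemma floor_quot_ge (a m q : int) : 0 < m ->
  (q <= floor_quot a m) = (m * q <= a).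
Proof.
move=> m0; have m0q : (0 : rat) < m%:~R by rewrite ltr0z.
by rewrite /floor_quot floor_ge_int ler_pdivlMr // -intrM ler_int mulrC.
Qed.

Lemma floor_quot_itv (a m : int) : 0 < m ->
  m * floor_quot a m <= a < m * (floor_quot a m + 1).
Proof.
move=> m0; rewrite -floor_quot_ge // lexx /= ltNge -floor_quot_ge //.
by rewrite -ltNge ltrDl.
Qed.

Lemma floor_quotDMl (k a m : int) : 0 < m ->
  floor_quot (m * k + a) m = k + floor_quot a m.
Proof.
move=> m0; have m0q : (m%:~R : rat) != 0 by rewrite intr_eq0 gt_eqF.
rewrite /floor_quot intrD intrM mulrDl mulrAC mulfV // mul1r.
by rewrite floorDzr ?intr_int // intrKfloor.
Qed.

(** Substituting numerals for [x], from [lo] on, makes products such as [m * x] linear for [lia].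
    When the fuel [n] runs out, the upper bound on [x] in the context refutes what is left. *)
Ltac int_cases x lo n :=
  lazymatch n with
  | O => exfalso; lia
  | S ?n' =>
    let E := fresh "E" in
    (have [E|E] : x = lo \/ lo + 1 <= x by lia);
    [ subst x; try (exfalso; lia) | int_cases x constr:(lo + 1) n' ]
  end.

(** The q's stand for floors, given by their brackets; through [floor_quot_ge] the conclusion bounds
    the floor of (15r - 1)/m from below. Multiples of 3 are excluded because the bound fails at r =
    2m/3. *)
Lemma residue_ineq3 (m r q1 q2 q4 q5 q12 : int) :
  1 < m -> ~~ (3 %| m)%Z -> 0 <= r < m ->
  m * q1 <= 2 < m * (q1 + 1) ->
  m * q2 <= 2 * r < m * (q2 + 1) ->
  m * q4 <= 4 * r < m * (q4 + 1) ->
  m * q5 <= 5 * r - 1 < m * (q5 + 1) ->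
  m * q12 <= 12 * r + 2 < m * (q12 + 1) ->
  m * (q12 + q2 + q5 - q1 - q4) <= 15 * r - 1.
Proof.
move=> m1 m3 hr h1 h2 h4 h5 h12.
(* Linear form of nondivisibility, with which [lia] can rule out 3r = 2m. *)
have [k [e [Em he]]] : exists k e : int, m = 3 * k + e /\ 1 <= e <= 2.
  by exists (m %/ 3)%Z, (m %% 3)%Z; lia.
move: m3 => _.
(* These ranges come from 0 <= r < m and m > 1; [q5] is -1 at r = 0. *)
have b1 : 0 <= q1 <= 1 by nia.
have b2 : 0 <= q2 <= 1 by nia.
have b4 : 0 <= q4 <= 3 by nia.
have b5 : -1 <= q5 <= 4 by nia.
have b12 : 0 <= q12 <= 13 by nia.
int_cases q1 0%:Z 2%N; int_cases q2 0%:Z 2%N; int_cases q4 0%:Z 4%N;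
  int_cases q5 (- 1%:Z) 6%N; int_cases q12 0%:Z 14%N; lia.
Qed.

(** Same scheme; for multiples of 5 the bound fails at r = 2m/5 and r = 4m/5. *)
Lemma residue_ineq5 (m r q2 q3 q4 q10 : int) :
  1 < m -> ~~ (5 %| m)%Z -> 0 <= r < m ->
  m * q2 <= 2 * r < m * (q2 + 1) ->
  m * q3 <= 3 * r - 1 < m * (q3 + 1) ->
  m * q4 <= 4 * r < m * (q4 + 1) ->
  m * q10 <= 10 * r + 1 < m * (q10 + 1) ->
  m * (q10 + q4 + q3 - q2) <= 15 * r - 1.
Proof.
move=> m1 m5 hr h2 h3 h4 h10.
have [k [e [Em he]]] : exists k e : int, m = 5 * k + e /\ 1 <= e <= 4.
  by exists (m %/ 5)%Z, (m %% 5)%Z; lia.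
move: m5 => _.
have b2 : 0 <= q2 <= 1 by nia.
have b3 : -1 <= q3 <= 2 by nia.
have b4 : 0 <= q4 <= 3 by nia.
have b10 : 0 <= q10 <= 10 by nia.
int_cases q2 0%:Z 2%N; int_cases q4 0%:Z 4%N; int_cases q3 (- 1%:Z) 4%N;
  int_cases q10 0%:Z 11%N; lia.
Qed.

Lemma floor_quot_affine (c d m k r : int) : 0 < m ->
  floor_quot (c * (m * k + r) + d) m = c * k + floor_quot (c * r + d) m.
Proof. by move=> m0; rewrite -floor_quotDMl // mulrDr mulrCA addrA. Qed.

Theorem theorem2p3 (m n : int) (hm : 1 < m) :
  (~~ (3 %| m)%Z ->
     floor_quot (15 * n - 1) m + floor_quot 2 m + floor_quot (4 * n) m >=
     floor_quot (12 * n + 2) m + floor_quot (2 * n) m + floor_quot (5 * n - 1) m)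
  /\
  (~~ (5 %| m)%Z ->
     floor_quot (15 * n - 1) m + floor_quot (2 * n) m >=
     floor_quot (10 * n + 1) m + floor_quot (4 * n) m + floor_quot (3 * n - 1) m).
Proof.
have m0 : 0 < m by lia.
have [k [r [-> hr]]] : exists k r : int, n = m * k + r /\ 0 <= r < m.
  exists (n %/ m)%Z, (n %% m)%Z; rewrite mulrC -divz_eq modz_ge0 ?ltz_pmod //.
  by rewrite gt_eqF.
(* The added zeros give these terms the shape [c * (m * k + r) + d]. *)
rewrite -[2 * (m * k + r)]addr0 -[4 * (m * k + r)]addr0 !floor_quot_affine //.
rewrite !addr0.
have itv a := floor_quot_itv a m0.
split=> hdvd.
(* The multiples of [k] cancel, as 15 + 4 = 12 + 2 + 5. *)
- have := residue_ineq3 hm hdvd hr (itv _) (itv _) (itv _) (itv _) (itv _).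
  by rewrite -floor_quot_ge //; do !move: (floor_quot _ _) => ?; lia.
(* Here they cancel because 15 + 2 = 10 + 4 + 3. *)
- have := residue_ineq5 hm hdvd hr (itv _) (itv _) (itv _) (itv _).
  by rewrite -floor_quot_ge //; do !move: (floor_quot _ _) => ?; lia.
Qed.
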